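(* Let $X$ be $\mathbb{A}$ or $\mathbb{O}$. Then every transformation group $(G,X)$ with phase space $X$ fails to be topological transitive; in particular, it is not Devaney chaotic.
   Context: Two topological spaces have underlying set $[0,1]\times[0,1]$ (points are written $\langle x,y\rangle$). (i) $\mathbb{O}$ has the order topology of the lexicographic order: $\langle x,y\rangle\preceq_\ell\langle s,t\rangle$ iff $x<s$, or $x=s$ and $y\le t$. (ii) $\mathbb{A}$ (the Alexandroff square) has the topology generated by the basis consisting of all sets $\{x\}\times U$ with $x\in[0,1]$, $U$ open in $[0,1]$ (Euclidean topology) and $x\notin U$, together with all sets $([0,1]\times U)\setminus(\{x_1,\ldots,x_n\}\times[0,1])$ with $U$ open in $[0,1]$ and $x_1,\dots,x_n\in[0,1]$ finitely many points. Both spaces are compact Hausdorff. A transformation group $(G,X)$ consists of a compact Hausdorff space $X$ (the phase space), a discrete topological group $G$ with identity $e$, and a continuous map $G\times X\to X$, $(g,x)\mapsto gx$, such that $ex=x$ and $g(hx)=(gh)x$ for all $g,h\in G$, $x\in X$. It is topological transitive if for all nonempty open subsets $U,V$ of $X$ we have $U\cap GV\neq\varnothing$, where $GV=\{gv:g\in G,v\in V\}$. A point $x\in X$ is periodic if its stabilizer $\{g\in G:gx=x\}$ is a finite index subgroup of $G$. $(G,X)$ is Devaney chaotic if it is topological transitive and the set of its periodic points is dense in $X$. *)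

(* Defs.v *)
From HB Require Import structures.
From mathcomp Require Import all_boot all_order all_algebra.
From mathcomp Require Import all_classical all_reals all_analysis.
Import numFieldNormedType.Exports.

Set Implicit Arguments.
Unset Strict Implicit.
Unset Printing Implicit Defensive.

Import Order.TTheory GRing.Theory Num.Theory.
Local Open Scope classical_set_scope.
Local Open Scope ring_scope.

Definition unit_itv (R : realType) : Type := set_type (`[0, 1] : set R).
HB.instance Definition _ (R : realType) :=
  Topological.copy (unit_itv R) (set_type (`[0, 1] : set R)).
HB.instance Definition _ (R : realType) := SubChoice.on (unit_itv R).
HB.instance Definition _ (R : realType) :=
  [SubChoice_isSubOrder of unit_itv R by <: with ring_display].

Definition lexi_square (R : realType) : Type :=
  order_topology (unit_itv R *l unit_itv R).
HB.instance Definition _ (R : realType) := OrderTopological.on (lexi_square R).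

(* A named alias of the product type: it must carry the topology
   generated below, not the product topology. *)
Definition alexandroff_square (R : realType) : Type :=
  (unit_itv R * unit_itv R)%type.
HB.instance Definition _ (R : realType) := Choice.on (alexandroff_square R).

Definition alexandroff_basis (R : realType) : set_system (alexandroff_square R) :=
  [set B | (exists (x : unit_itv R) (U : set (unit_itv R)),
              [/\ open U, ~ U x & B = [set x] `*` U]) \/
           (exists (U : set (unit_itv R)) (F : set (unit_itv R)),
              [/\ open U, finite_set F & B = (setT `*` U) `\` (F `*` setT)])].

Section alexandroff_topology.
Variable R : realType.

Let alexandroff_cover :
  \bigcup_(B in @alexandroff_basis R) B = [set: alexandroff_square R].
Proof.
rewrite -subTset => p _; exists [set: alexandroff_square R] => //.
right; exists setT, set0; split => //; first exact: openT.
by rewrite set0X setD0 setXTT.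
Qed.

Let alexandroff_join (B C : set (alexandroff_square R)) t :
  alexandroff_basis B -> alexandroff_basis C -> B t -> C t ->
  exists D, [/\ alexandroff_basis D, D t & D `<=` B `&` C].
Proof.
case: t => a b BB BC Bt Ct.
case: BB => [[x [U [oU Ux EB]]]|[U [F [oU fF EB]]]];
  case: BC => [[y [V [oV Vy EC]]]|[V [H [oV fH EC]]]]; subst B C.
- case: Bt Ct => /= -> Ub [/= xy Vb].
  exists ([set x] `*` (U `&` V)); split => //; last first.
    by move=> [c d] [/= -> [Ud Vd]]; split.
  by left; exists x, (U `&` V); split => [||//]; [exact: openI|case].
- case: Bt Ct => /= -> Ub [[_ Vb] nH].
  exists ([set x] `*` (U `&` V)); split => //; last first.
    by move=> [c d] [/= -> [Ud Vd]]; split; split => //= -[Hx _]; apply: nH.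
  by left; exists x, (U `&` V); split => [||//]; [exact: openI|case].
- case: Ct Bt => /= -> Vb [[_ Ub] nF].
  exists ([set y] `*` (U `&` V)); split => //; last first.
    by move=> [c d] [/= -> [Ud Vd]]; split; split => //= -[Fy _]; apply: nF.
  by left; exists y, (U `&` V); split => [||//]; [exact: openI|case].
- case: Bt Ct => [[_ Ub] nF] [[_ Vb] nH].
  exists ((setT `*` (U `&` V)) `\` ((F `|` H) `*` setT)); split.
  + right; exists (U `&` V), (F `|` H); split => //; first exact: openI.
    by rewrite finite_setU.
  + by split => //= -[[? | ?] _]; [apply: nF | apply: nH].
  + move=> [c d] [[_ [Ud Vd]] nFH]; split; split => //= -[cc _]; apply: nFH.
      by split => //; left.
    by split => //; right.
Qed.

HB.instance Definition _ := @isBaseTopological.Build (alexandroff_square R)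
  (set (alexandroff_square R)) (@alexandroff_basis R) id
  alexandroff_cover alexandroff_join.

End alexandroff_topology.

Section transformation_groups.
Variables (G : groupType) (X : topologicalType) (act : G -> X -> X).
Local Open Scope group_scope.

Record transformation_group : Prop := TransformationGroup {
  phase_compact : compact [set: X];
  phase_hausdorff : hausdorff_space X;
  act_continuous : continuous (fun p : discrete_topology G * X => act p.1 p.2);
  act1 : forall x, act 1 x = x;
  actM : forall g h x, act g (act h x) = act (g * h) x
}.

Definition topological_transitive : Prop :=
  forall U V : set X, open U -> open V -> U !=set0 -> V !=set0 ->
    U `&` [set act g v | g in [set: G] & v in V] !=set0.

Definition stabilizer (x : X) : set G := [set g | act g x = x].

(* The index is the cardinality of the set of left cosets. *)
Definition finite_index_subgroup (H : set G) : Prop :=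
  group_closed (mem H) /\
  finite_set (range (fun g : G => [set g * h | h in H])).

Definition periodic_point (x : X) : Prop := finite_index_subgroup (stabilizer x).

Definition devaney_chaotic : Prop :=
  topological_transitive /\ dense periodic_point.

End transformation_groups.

(* Main.v *)
(* Call a point separable when it has a neighborhood with a countable dense
   subset; the acting homeomorphisms permute the separable points, hence also the
   connected components of the set of these points.
   In the Alexandroff square the non-separable points are those of the diagonal,
   and the components are the half-fibers {x} x [0,x) and {x} x (x,1].
   Transitivity gives g with g({1/2} x [0,1/2)) = {0} x (0,1], so g maps
   (1/2,1/2) to (0,0); but two components accumulate at (1/2,1/2) and only one
   at (0,0).
   In the lexicographic square, {0} x [0,1) is a component whose only
   non-separable limit point is (0,1), whereas (1/2,0) and (1/2,1) are two
   non-separable limit points of {1/2} x (0,1); transitivity gives g mapping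
   the latter set into the former, and then both of its ends to (0,1). *)
Require Import Defs.
From mathcomp Require Import all_boot all_order all_algebra.
From mathcomp Require Import all_classical all_reals all_analysis.
Import numFieldNormedType.Exports.
Import Order.TTheory GRing.Theory Num.Theory.

Set Implicit Arguments.
Unset Strict Implicit.
Unset Printing Implicit Defensive.

Local Open Scope classical_set_scope.
Local Open Scope ring_scope.

Lemma countable_image (T U : Type) (f : T -> U) (A : set T) :
  countable A -> countable (f @` A).
Proof. exact/sub_countable/card_image_le. Qed.

Lemma countable_setU (T : Type) (A B : set T) :
  countable A -> countable B -> countable (A `|` B).
Proof.
move=> cA cB; have -> : A `|` B = \bigcup_(b : bool) if b then A else B.
  apply/seteqP; split=> [x [Ax|Bx]|x [[] _ Cx]]; by
    [exists true|exists false|left|right].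
by apply: bigcup_countable => // -[].
Qed.

(** * Separable points and relatively clopen sets *)

Section separable_points.
Variable T : topologicalType.

(** [Q] may stick out of [N]: density is tested only on open subsets of [N], so that the image of
    all rationals can serve for any [N] lying on a curve. *)
Definition separable_at (p : T) := exists N Q : set T,
  [/\ open N, N p, countable Q &
      forall B, open B -> B `<=` N -> B !=set0 -> B `&` Q !=set0].

(** A nonempty open subset of [N] pulls back along [c] to a nonempty open set of reals, which
    contains a rational. *)
Lemma separable_at_curve (R : realType) (c : R -> T) (N : set T) (p : T) :
  continuous c -> open N -> N `<=` range c -> N p -> separable_at p.
Proof.
move=> /continuousP cc oN Nc Np; exists N, (c @` range ratr); split => //.
  by apply: countable_image; apply: countable_image; apply: countableP.
move=> B oB BN [q Bq]; have [t _ ctq] := Nc _ (BN _ Bq).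
have [s [Bs Qs]] : c @^-1` B `&` range (@ratr R) !=set0.
  by apply: dense_rat; [exists t; rewrite /preimage /= ctq|exact: cc].
by exists (c s); split => //; exists s.
Qed.

Lemma not_separable_at (I : Type) (pr : T -> I) (p : T) :
  (forall N, open N -> N p -> exists2 S : set I, ~ countable S &
     forall y, S y -> exists B : set T,
       [/\ open B, B !=set0, B `<=` N & B `<=` pr @^-1` [set y]]) ->
  ~ separable_at p.
Proof.
move=> pS [N [Q [oN Np cQ NQ]]]; have [S + SB] := pS N oN Np; apply.
apply: (@sub_countable _ _ _ (pr @` Q)); last exact: countable_image.
apply: subset_card_le => y /SB[B [oB B0 BN By]].
by have [q [Bq Qq]] := NQ B oB BN B0; exists q => //; exact: By.
Qed.

(* Contains the component in [D] of each of its points. *)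
Definition absorbing (D K : set T) := forall C, connected C -> C `<=` D ->
  C `&` K !=set0 -> C `<=` K.

(** The hypotheses make the trace of [K] on [D] clopen in [D], so a connected subset of [D] that
    meets [K] cannot leave it. *)
Lemma clopen_absorbing (D K : set T) :
  open K -> closure K `&` D `<=` K -> absorbing D K.
Proof.
move=> oK KD C cC CD CK.
suff <- : C `&` K = C by exact: subIsetr.
apply: cC => //; first by exists K.
exists (closure K); first exact: closed_closure.
apply/seteqP; split=> q [Cq Kq]; split => //; first exact: subset_closure.
by apply: KD; split => //; exact: CD.
Qed.

End separable_points.

Arguments separable_at {T} p.

(** * Continuous curves: limits at the ends of an arc, and connectedness *)

Section curves.
Variables (R : realType) (T : topologicalType) (c : R -> T) (a b : R).
Hypotheses (ab : a < b) (cc : continuous c).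

Lemma closed_curve_left (F : set T) :
  closed F -> c @` `]a, b[ `<=` F -> F (c a).
Proof.
move=> cF abF; apply: (closed_cvg F cF (F := a^'+) (u_ := c)); last first.
  by apply: cvg_at_right_filter; exact: cc.
near=> t; apply: abF; exists t => //=; rewrite in_itv /=; apply/andP; split.
  by near: t; exact: nbhs_right_gt.
by near: t; exact: nbhs_right_lt.
Unshelve. all: by end_near. Qed.

Lemma closed_curve_right (F : set T) :
  closed F -> c @` `]a, b[ `<=` F -> F (c b).
Proof.
move=> cF abF; apply: (closed_cvg F cF (F := b^'-) (u_ := c)); last first.
  by apply: cvg_at_left_filter; exact: cc.
near=> t; apply: abF; exists t => //=; rewrite in_itv /=; apply/andP; split.
  by near: t; exact: nbhs_left_gt.
by near: t; exact: nbhs_left_lt.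
Unshelve. all: by end_near. Qed.

Lemma connected_curve (A : set R) : is_interval A -> connected (c @` A).
Proof.
move=> /connected_intervalP cA; apply: connected_continuous_connected => //.
exact: continuous_subspaceT.
Qed.

End curves.

(** Countable sets have Lebesgue measure zero, while this interval has measure [b - a]. *)
Lemma uncountable_itvoo (R : realType) (a b : R) : a < b -> ~ countable `]a, b[.
Proof.
move=> ab /countable_lebesgue_measure0/eqP.
rewrite lebesgue_measure_itv /= lte_fin ab -EFinB eqe subr_eq0 => /eqP ba.
by rewrite ba ltxx in ab.
Qed.

(** * Invariance of separability under the acting homeomorphisms *)

Section actions.
Variables (G : groupType) (X : topologicalType) (act : G -> X -> X).
Hypothesis actX : transformation_group act.

Lemma act_continuousr g : continuous (act g).
Proof.
move=> x; pose inc (y : X) : discrete_topology G * X := (g, y).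
have ci : {for x, continuous inc}.
  apply: (@cvg_pair _ _ _ (nbhs x) (nbhs (g : discrete_topology G)) (nbhs x)).
    exact: cvg_cst.
  exact: cvg_id.
exact: (continuous_comp ci (act_continuous actX (x := inc x))).
Qed.

Lemma actK g : cancel (act g) (act g^-1%g).
Proof. by move=> x; rewrite (actM actX) mulVg (act1 actX). Qed.

Lemma actVK g : cancel (act g^-1%g) (act g).
Proof. by move=> x; rewrite (actM actX) mulgV (act1 actX). Qed.

(** The homeomorphism [act g], with inverse [act g^-1], carries both [N] and [Q] along. *)
Lemma separable_at_act g p : separable_at p -> separable_at (act g p).
Proof.
have /continuousP cg := act_continuousr (g := g).
have /continuousP cV := act_continuousr (g := g^-1%g).
move=> [N [Q [oN Np cQ NQ]]].
exists (act g^-1%g @^-1` N), (act g @` Q); split.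
- exact: cV.
- by rewrite /preimage /= actK.
- exact: countable_image.
- move=> B oB BN [q Bq].
  have [||s [Bs Qs]] := NQ (act g @^-1` B) (cg _ oB).
  + by move=> x /= /BN /=; rewrite actK.
  + by exists (act g^-1%g q); rewrite /preimage /= actVK.
  by exists (act g s); split => //; exists s.
Qed.

Lemma separable_at_actE g p : separable_at (act g p) <-> separable_at p.
Proof.
by split=> [/(separable_at_act g^-1%g)|/(separable_at_act g)//]; rewrite actK.
Qed.

(** The image of [C] is again a connected set of separable points, and it meets [K] at [act g p]. *)
Lemma act_absorbing g (C K : set X) p : connected C ->
  C `<=` separable_at -> absorbing separable_at K ->
  C p -> K (act g p) -> act g @` C `<=` K.
Proof.
move=> cC CD KD Cp Kgp; apply: KD.
- apply: connected_continuous_connected => //.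
  by apply: continuous_subspaceT; exact: act_continuousr.
- by move=> _ [q Cq <-]; apply: separable_at_act; exact: CD.
- by exists (act g p); split => //; exists p.
Qed.

End actions.

(** * The unit interval as a retract of the real line *)

Section unit_interval.
Variable R : realType.
Implicit Types (x y : unit_itv R) (t : R).

Let clamp_subproof t : Order.max 0 (Order.min 1 t) \in (`[0, 1]%classic : set R).
Proof.
apply/mem_set; rewrite /= in_itv /= le_max lexx /= ge_max ler01 /=.
by rewrite ge_min lexx.
Qed.

(** Retracting the line onto the interval lets the fibers of both squares be parametrized by curves
    defined on all of [R]. *)
Definition clamp t : unit_itv R := SigSub (clamp_subproof t).

Lemma val_itv01 x : 0 <= val x <= 1.
Proof. by have := set_mem (valP x); rewrite /= in_itv. Qed.

Lemma val_clamp t : 0 <= t <= 1 -> val (clamp t) = t.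
Proof.
by move=> /andP[t0 t1] /=; rewrite (min_idPr t1) (max_idPr t0).
Qed.

Lemma clampK x : clamp (val x) = x.
Proof. by apply: val_inj; rewrite val_clamp// val_itv01. Qed.

Lemma continuous_clamp : continuous clamp.
Proof.
apply/continuousP => _ [A oA <-].
have : continuous (val \o clamp : R -> R).
  move=> t.
  apply: (@continuous_max R R (cst 0) (fun t => Order.min 1 t)).
    exact: cvg_cst.
  apply: (@continuous_min R R (cst 1) id).
    exact: cvg_cst.
  exact: cvg_id.
by move=> /continuousP /(_ _ oA).
Qed.

Lemma continuous_val : continuous (val : unit_itv R -> R).
Proof. exact: initial_continuous. Qed.

Lemma lt_val_itv x y : (x < y) = (val x < val y).
Proof. by []. Qed.

Lemma le_val_itv x y : (x <= y) = (val x <= val y).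
Proof. by []. Qed.

Lemma open_lt_itv y : open [set x | x < y].
Proof.
have -> : [set x | x < y] = val @^-1` `]-oo, val y[.
  by apply/seteqP; split=> x /=; rewrite in_itv.
move/continuousP: continuous_val; apply; exact: lray_open.
Qed.

Lemma open_gt_itv y : open [set x | y < x].
Proof.
have -> : [set x | y < x] = val @^-1` `]val y, +oo[.
  by apply/seteqP; split=> x /=; rewrite in_itv /= andbT.
move/continuousP: continuous_val; apply; exact: rray_open.
Qed.

Lemma uncountable_unit_itv x y : x < y -> ~ countable [set z | x < z < y].
Proof.
move=> xy cS; apply: (@uncountable_itvoo R (val x) (val y)) => //.
apply: sub_countable (countable_image val cS); apply: subset_card_le => t /=.
rewrite in_itv /= => /andP[xt ty].
have tE : val (clamp t) = t.
  apply: val_clamp; have /andP[x0 _] := val_itv01 x.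
  have /andP[_ y1] := val_itv01 y.
  by rewrite (le_trans x0 (ltW xt)) (le_trans (ltW ty) y1).
by exists (clamp t) => //=; rewrite !lt_val_itv tE xt.
Qed.

End unit_interval.

Section end_points.
Variable R : realType.
Implicit Types x y : unit_itv R.

Lemma clamp0_le x : clamp 0 <= x.
Proof.
by rewrite le_val_itv val_clamp ?lexx ?ler01//; have /andP[] := val_itv01 x.
Qed.

Lemma le_clamp1 x : x <= clamp 1.
Proof.
by rewrite le_val_itv val_clamp ?lexx ?ler01//; have /andP[] := val_itv01 x.
Qed.

Lemma lt_clamp (s t : R) : 0 <= s -> s < t -> t <= 1 -> clamp s < clamp t.
Proof.
move=> s0 st t1; rewrite lt_val_itv !val_clamp//.
  by rewrite t1 (le_trans s0 (ltW st)).
by rewrite s0 (le_trans (ltW st) t1).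
Qed.

Lemma half_gt0 : 0 < 2^-1 :> R. Proof. by rewrite invr_gt0 ltr0n. Qed.
Lemma half_lt1 : 2^-1 < 1 :> R. Proof. by rewrite invf_lt1 ?ltr1n ?ltr0n. Qed.

End end_points.

(** * The Alexandroff square *)

Section alexandroff.
Variable R : realType.
Local Notation A := (alexandroff_square R).
Implicit Types (p q : A) (x : unit_itv R).

Lemma open_alexandroff_basis (B : set A) : alexandroff_basis B -> open B.
Proof.
move=> bB; exists [set B]; first by move=> _ ->.
by rewrite bigcup_set1.
Qed.

Lemma alexandroff_basisP (B : set A) p : open B -> B p ->
  exists C, [/\ alexandroff_basis C, C p & C `<=` B].
Proof.
move=> [D DB <-] [C DC Cp]; exists C; split => //; first exact: DB.
by move=> q Cq; exists C.
Qed.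

Definition afiber x (t : R) : A := (x, clamp t).

(** A basic set of either kind that meets the fiber over [x] cuts out of it a set given by its open
    factor [U]: in the second kind, meeting the fiber forces [x] outside [F]. *)
Lemma continuous_afiber x : continuous (afiber x).
Proof.
have /continuousP cclamp := @continuous_clamp R.
apply/continuousP => B oB; rewrite openE => t Bt.
have [C [bC Cp CB]] := alexandroff_basisP oB Bt.
case: bC => [[y [U [oU Uy CE]]]|[U [F [oU fF CE]]]]; subst C.
- case: Cp => /= -> Ut; apply: (@filterS _ _ _ (@clamp R @^-1` U)).
    by move=> s Us; apply: CB.
  by apply: open_nbhs_nbhs; split => //; exact: cclamp.
- case: Cp => -[_ /= Ut] nF; apply: (@filterS _ _ _ (@clamp R @^-1` U)).
    by move=> s Us; apply: CB; split => //= -[Fx _]; exact: nF.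
  by apply: open_nbhs_nbhs; split => //; exact: cclamp.
Qed.

(** Only basic sets of the second kind contain a diagonal point, and such a set contains a nonempty
    open piece of each fiber over the uncountable complement of [F] and [x]. *)
Lemma not_separable_at_diagonal x : ~ separable_at ((x, x) : A).
Proof.
apply: (@not_separable_at A (unit_itv R) fst) => N oN Nx.
have [C [bC Cx CN]] := alexandroff_basisP oN Nx.
case: bC => [[y [U [oU Uy CE]]]|[U [F [oU fF CE]]]]; subst C.
  by case: Cx => /= -> /Uy.
case: Cx => -[_ /= Ux] nFx; exists (~` (F `|` [set x])).
  move=> cFx; apply: (@uncountable_unit_itv R (clamp 0) (clamp 1)).
    exact: lt_clamp.
  apply: (sub_countable (B := (F `|` [set x]) `|` ~` (F `|` [set x]))).
    by rewrite setUv; exact: subset_card_le.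
  apply: countable_setU => //; apply: countable_setU; last exact: countable1.
  exact: finite_set_countable.
(* Deleting [y] from [U] makes this a basic set of the first kind. It still contains [(y, x)],
   because [y] differs from [x]. *)
move=> y nFy; exists ([set y] `*` (U `&` ([set z | z < y] `|` [set z | y < z]))).
split.
- apply: open_alexandroff_basis; left; exists y.
  exists (U `&` ([set z | z < y] `|` [set z | y < z])); split => //.
    by apply: openI => //; apply: openU; [exact: open_lt_itv|exact: open_gt_itv].
  by rewrite /= ltxx => -[_ []].
- exists (y, x); split => //; split => //=.
  by apply/orP; rewrite -neq_lt; apply/eqP => xy; apply: nFy; right.
- by move=> [a z] [/= -> [Uz _]]; apply: CN; split => //= -[Fy _]; apply: nFy; left.
- by move=> [a z] [].
Qed.

(* The connected components of the complement of the diagonal. *)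
Definition half_fiber q : set A :=
  [set p | [/\ p.1 = q.1, p.2 != p.1 & (p.2 < p.1) = (q.2 < q.1)]].

Lemma open_half_fiber q : open (half_fiber q).
Proof.
apply: open_alexandroff_basis; left; exists q.1.
exists (if q.2 < q.1 then [set z | z < q.1] else [set z | q.1 < z]); split.
- by case: ifP => _; [exact: open_lt_itv|exact: open_gt_itv].
- by case: ifP => _ /=; rewrite ltxx.
- apply/seteqP; split=> -[a b] /=.
    move=> [/= -> ba bq]; split => //=.
    case: ifP bq => /= qq; first by move=> ->.
    by move: ba; rewrite neq_lt => /orP[-> //|].
  move=> [/= ->]; case: ifP => /= qq ba.
    by split => //=; rewrite ?qq // lt_eqF.
  by split => //=; [rewrite gt_eqF|rewrite qq; apply/negbTE; rewrite -leNgt ltW].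
Qed.

Lemma half_fiber_afiber q : half_fiber q `<=` range (afiber q.1).
Proof.
by move=> [a b] [/= -> _ _]; exists (val b) => //; rewrite /afiber clampK.
Qed.

Lemma half_fiber_separable q : half_fiber q `<=` separable_at.
Proof.
move=> p; apply: separable_at_curve (open_half_fiber q) (@half_fiber_afiber q).
exact: continuous_afiber.
Qed.

Lemma separable_at_alexandroff p : separable_at p <-> p.2 != p.1.
Proof.
split=> [|pp]; last by apply: (@half_fiber_separable p); split.
by case: p => a b sp; apply/eqP => /= ba; subst b; exact: not_separable_at_diagonal sp.
Qed.

(** A separable point in the closure has its own half-fiber as an open neighborhood, and two
    half-fibers that meet coincide. *)
Lemma absorbing_half_fiber q : absorbing separable_at (half_fiber q).
Proof.
apply: clopen_absorbing; first exact: open_half_fiber.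
move=> p [qp /separable_at_alexandroff pp].
have [|r [[r1 r2 r3] [s1 s2 s3]]] := qp (half_fiber p).
  by apply: open_nbhs_nbhs; split; [exact: open_half_fiber|].
by split; [rewrite -s1|exact: pp|rewrite -s3].
Qed.

(** The parameters in [[0, 1]] on one fixed side of [val q.1] form an interval. *)
Lemma connected_half_fiber q : connected (half_fiber q).
Proof.
have -> : half_fiber q = afiber q.1 @` [set t | [/\ 0 <= t <= 1, t != val q.1
    & (t < val q.1) = (q.2 < q.1)]].
  apply/seteqP; split.
    move=> [a b] [/= -> ba bq]; exists (val b); last by rewrite /afiber clampK.
    by split => //; exact: val_itv01.
  move=> _ [t [t01 tq tlt] <-]; split => //=.
    by apply: contra_neq tq => <-; rewrite val_clamp.
  by rewrite lt_val_itv val_clamp.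
apply: connected_curve; first exact: continuous_afiber.
move=> s t [/andP[s0 s1] sq ss] [/andP[t0 t1] tq tt] z /andP[sz zt].
split; first by rewrite (le_trans s0 sz) (le_trans zt t1).
  apply/eqP => zq; subst z; move: ss; rewrite lt_neqAle sq sz /= -tt => /esym.
  by rewrite ltNge zt.
apply/idP/idP => [zq|qq]; first by rewrite -ss (le_lt_trans sz).
by rewrite (le_lt_trans zt) // tt.
Qed.

Lemma closed_afiber x : closed [set p : A | p.1 = x].
Proof.
rewrite -openC; apply: open_alexandroff_basis; right; exists setT, [set x].
split; [exact: openT|exact: finite_set1|].
apply/seteqP; split=> -[a b]; first by move=> ax; split => // -[].
by move=> [_ ax] /= E; apply: ax.
Qed.

Lemma alexandroff_not_transitive (G : groupType) (act : G -> A -> A) :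
  transformation_group act -> ~ topological_transitive act.
Proof.
move=> actA; pose h : unit_itv R := clamp 2^-1.
have h0 : clamp 0 < h.
  by apply: lt_clamp; [exact: lexx|exact: half_gt0|exact/ltW/half_lt1].
have h1 : h < clamp 1.
  by apply: lt_clamp; [exact/ltW/half_gt0|exact: half_lt1|exact: lexx].
have i01 : clamp 0 < clamp 1 :> unit_itv R by exact: lt_clamp.
(* [q0] marks the only nonempty half of the fiber over [clamp 0]; [ql] and [qr] mark the lower and
   upper halves over [h]. *)
pose q0 : A := (clamp 0, clamp 1).
pose ql : A := (h, clamp 0).
pose qr : A := (h, clamp 1).
have q0_self : half_fiber q0 q0 by split; rewrite //= gt_eqF.
have ql_self : half_fiber ql ql by split; rewrite //= lt_eqF.
have qr_self : half_fiber qr qr by split; rewrite //= gt_eqF.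
move=> /(_ _ _ (open_half_fiber q0) (open_half_fiber ql)).
case; [by exists q0|by exists ql|].
move=> y [q0gw [g _ [w qlw gwE]]]; rewrite -gwE in q0gw.
have act_half (k : G) (p q : A) : half_fiber q (act k p) -> separable_at p ->
    act k @` half_fiber p `<=` half_fiber q.
  move=> qp /separable_at_alexandroff pp.
  have pfp : half_fiber p p by split.
  exact: (act_absorbing actA (@connected_half_fiber p) (@half_fiber_separable p)
    (@absorbing_half_fiber q) pfp qp).
have cact (k : G) x : continuous (act k \o afiber x).
  move=> t; apply: continuous_comp; first exact: continuous_afiber.
  exact: act_continuousr.
have w_sep : separable_at w by apply: (half_fiber_separable qlw).
have ql_q0 : act g @` half_fiber ql `<=` half_fiber q0.
  move=> _ [p [p1 p2 p3] <-]; case: qlw => w1 w2 w3.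
  by apply: (act_half _ _ _ q0gw w_sep); exists p => //; split;
    [rewrite w1| |rewrite w3].
(* The image is a limit of points in the closed fiber over [clamp 0], and it is not separable, hence
   diagonal. *)
have gd : act g (afiber h 2^-1) = (clamp 0, clamp 0) :> A.
  have /= g1 : [set p : A | p.1 = clamp 0] ((act g \o afiber h) 2^-1).
    apply: (closed_curve_right (half_gt0 R) (cact g h) (@closed_afiber _)).
    move=> z [t + <-]; rewrite /= in_itv /= => /andP[t0 th].
    have [] // : half_fiber q0 (act g (afiber h t)).
    apply: ql_q0; exists (afiber h t) => //.
    have th' : clamp t < h.
      by apply: lt_clamp; [exact: ltW|exact: th|exact/ltW/half_lt1].
    by split => //=; [rewrite lt_eqF|rewrite th' h0].
  have : ~ separable_at (act g (afiber h 2^-1)).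
    by move/(separable_at_actE actA); exact: not_separable_at_diagonal.
  move=> /separable_at_alexandroff; move: g1.
  by case: (act g _) => a b /= -> /negP; rewrite negbK => /eqP ->.
have qr_sep : separable_at qr by exact: half_fiber_separable qr_self.
have gqr_sep := separable_at_act actA g qr_sep.
have /separable_at_alexandroff gqr := gqr_sep.
have gqr_self : half_fiber (act g qr) (act g qr) by split.
(* Both halves of the fiber over [h] end at its diagonal point, so [g] sends the
   upper half, too, into the only half-fiber ending at the image of that point. *)
have gqr1 : (act g qr).1 = clamp 0.
  suff : [set p : A | p.1 = (act g qr).1] ((act g \o afiber h) 2^-1).
    by rewrite /= gd.
  apply: (closed_curve_left (half_lt1 R) (cact g h) (@closed_afiber _)).
  move=> z [t + <-]; rewrite /= in_itv /= => /andP[ht t1].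
  have ht' : h < clamp t.
    by apply: lt_clamp; [exact/ltW/half_gt0|exact: ht|exact: ltW].
  have [] // : half_fiber (act g qr) (act g (afiber h t)).
  apply: (act_half g qr _ gqr_self qr_sep).
  exists (afiber h t) => //; split => //=; first by rewrite gt_eqF.
  by rewrite !ltNge !ltW.
(* No second coordinate is below [clamp 0], so an off-diagonal point of this fiber lies in its upper
   half. *)
have q0gqr : half_fiber q0 (act g qr).
  by split => //; rewrite gqr1 !ltNge clamp0_le /= ltW.
have q0_sep : separable_at (act g w) by exact: half_fiber_separable q0gw.
(* The inverse of [g] maps the half-fiber of [q0], which contains both [act g w] and [act g qr],
   into that of [ql]; this would put [qr] below the diagonal. *)
have [] : half_fiber ql qr.
  rewrite -(actK actA g qr).
  apply: (act_half g^-1%g (act g w)) => //; first by rewrite actK.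
  exists (act g qr) => //; case: q0gw => w1 w2 w3; case: q0gqr => r1 r2 r3.
  by split; [rewrite w1| |rewrite w3].
by move=> _ _ /=; rewrite h0 ltNge ltW.
Qed.

End alexandroff.

(** * The lexicographic square *)

Section lexicographic.
Variable R : realType.
Local Notation O := (lexi_square R).
Implicit Types (p q : O) (x : unit_itv R).

Lemma lt_lexi_square p q :
  (p < q)%O = (p.1 < q.1) || (p.1 == q.1) && (p.2 < q.2).
Proof.
case: p q => a b [c d]; transitivity ((a <= c) && ((c <= a) ==> (b < d))).
  exact: ltxi_pair.
by case: (ltgtP a c).
Qed.

Definition lfiber x (t : R) : O := (x, clamp t).

Lemma open_lfiber_preimage_lray x p : open (lfiber x @^-1` `]-oo, p[).
Proof.
have -> : lfiber x @^-1` `]-oo, p[ =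
    if x < p.1 then setT else if x == p.1 then @clamp R @^-1` [set z | z < p.2]
    else set0.
  apply/seteqP; split=> t /=; rewrite in_itv /= lt_lexi_square /=;
    by case: (ltgtP x p.1).
case: ifP => _; first exact: openT.
case: ifP => _; last exact: open0.
by move/continuousP: (@continuous_clamp R); apply; exact: open_lt_itv.
Qed.

Lemma open_lfiber_preimage_rray x p : open (lfiber x @^-1` `]p, +oo[).
Proof.
have -> : lfiber x @^-1` `]p, +oo[ =
    if p.1 < x then setT else if p.1 == x then @clamp R @^-1` [set z | p.2 < z]
    else set0.
  apply/seteqP; split=> t /=; rewrite in_itv /= andbT lt_lexi_square /=;
    by case: (ltgtP p.1 x).
case: ifP => _; first exact: openT.
case: ifP => _; last exact: open0.
by move/continuousP: (@continuous_clamp R); apply; exact: open_gt_itv.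
Qed.

Lemma continuous_lfiber x : continuous (lfiber x).
Proof.
move=> t B; rewrite itv_nbhsE => -[i [oi ti] iB].
apply: (@filterS _ _ _ (lfiber x @^-1` [set` i])); first by move=> s; exact: iB.
apply: open_nbhs_nbhs; split => //.
(* Openness of the ends leaves four shapes: a bounded open interval, two open rays and the whole
   space. *)
case: i oi {ti iB} => -[[]a|[]] [[]b|[]] // _.
- rewrite set_itv_splitI preimage_setI; apply: openI.
    exact: open_lfiber_preimage_rray.
  exact: open_lfiber_preimage_lray.
- exact: open_lfiber_preimage_rray.
- exact: open_lfiber_preimage_lray.
- by rewrite set_itvE preimage_setT; exact: openT.
Qed.

(** Written as an order interval, the fiber without its two ends is open at once; [open_fiberE]
    recovers it as a curve. *)
Definition open_fiber x : set O := `](x, clamp 0) : O, (x, clamp 1) : O[.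

Lemma open_fiberE x : open_fiber x = lfiber x @` `]0, 1[.
Proof.
apply/seteqP; split.
  move=> [a b]; rewrite /open_fiber /= in_itv /= !lt_lexi_square /=.
  move=> /andP[]; case: (ltgtP x a) => //= <- b0 b1.
  exists (val b); last by rewrite /lfiber clampK.
  rewrite /= in_itv /=; move: b0 b1; rewrite !lt_val_itv.
  by rewrite !val_clamp ?lexx ?ler01// => -> ->.
move=> p [t]; rewrite /= in_itv /= => /andP[t0 t1] <-.
rewrite /open_fiber /= in_itv /= !lt_lexi_square /= ltxx eqxx /=.
by rewrite !lt_clamp// ltW.
Qed.

Lemma open_fiber_separable x : open_fiber x `<=` separable_at.
Proof.
move=> p; apply: separable_at_curve (@continuous_lfiber x) _ _.
  exact: itv_open.
by rewrite open_fiberE => _ [t _ <-]; exists t.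
Qed.

Lemma connected_open_fiber x : connected (open_fiber x).
Proof.
rewrite open_fiberE; apply: connected_curve; first exact: continuous_lfiber.
exact: interval_is_interval.
Qed.

Lemma open_fiber_half x : open_fiber x (lfiber x 2^-1).
Proof.
by rewrite open_fiberE; exists 2^-1 => //; rewrite /= in_itv /= half_gt0 half_lt1.
Qed.

(** A strip contains uncountably many open fibers, which are told apart by the first coordinate. *)
Lemma not_separable_at_strip p :
  (forall N : set O, open N -> N p -> exists x y : unit_itv R,
     x < y /\ forall q, x < q.1 < y -> N q) -> ~ separable_at p.
Proof.
move=> pS; apply: (@not_separable_at O (unit_itv R) fst) => N oN Np.
have [x [y [xy xyN]]] := pS N oN Np; exists [set z | x < z < y].
  exact: uncountable_unit_itv.
move=> z xzy; exists (open_fiber z).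
have zfst : open_fiber z `<=` fst @^-1` [set z].
  by rewrite open_fiberE => _ [t _ <-].
split; [exact: itv_open|by exists (lfiber z 2^-1); exact: open_fiber_half| |exact: zfst].
by move=> q /zfst qz; apply: xyN; rewrite qz.
Qed.

(** Every point after [(x, clamp 1)] lies over a larger first coordinate, so a neighborhood contains
    a whole strip just to the right of [x]. *)
Lemma not_separable_at_top x : x < clamp 1 -> ~ separable_at ((x, clamp 1) : O).
Proof.
move=> x1; apply: not_separable_at_strip => N oN Nx.
have : nbhs ((x, clamp 1) : O) N by exact: open_nbhs_nbhs.
rewrite itv_nbhsE => -[[l r] [oi /andP[lx xr]] iN].
have lq q : x < q.1 -> (l <= BLeft q)%O.
  move=> xq; apply: (le_trans lx); rewrite bnd_simp ltW // lt_lexi_square.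
  by rewrite xq.
case: r oi xr iN => [[] [a b] oi xr iN| b oi xr iN].
- have xa : x < a.
    move: xr; rewrite /= bnd_simp lt_lexi_square /= => /orP[//|/andP[_]].
    by rewrite ltNge le_clamp1.
  exists x, a; split => // q /andP[xq qa]; apply: iN => /=.
  by rewrite itv_boundlr lq //= bnd_simp lt_lexi_square qa.
- by have := itv_open_ends_rside oi.
- exists x, (clamp 1); split => // q /andP[xq q1]; apply: iN => /=.
  by rewrite itv_boundlr lq //= (itv_open_ends_rinfty oi).
Qed.

Lemma not_separable_at_bottom x :
  clamp 0 < x -> ~ separable_at ((x, clamp 0) : O).
Proof.
move=> x0; apply: not_separable_at_strip => N oN Nx.
have : nbhs ((x, clamp 0) : O) N by exact: open_nbhs_nbhs.
rewrite itv_nbhsE => -[[l r] [oi /andP[lx xr]] iN].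
have rq q : q.1 < x -> (BRight q <= r)%O.
  move=> qx; apply: le_trans xr; rewrite bnd_simp ltW // lt_lexi_square.
  by rewrite qx.
case: l oi lx iN => [[] [a b] oi lx iN| b oi lx iN].
- by have := itv_open_ends_lside oi.
- have ax : a < x.
    move: lx; rewrite /= bnd_simp lt_lexi_square /= => /orP[//|/andP[_]].
    by rewrite ltNge clamp0_le.
  exists a, x; split => // q /andP[aq qx]; apply: iN => /=.
  by rewrite itv_boundlr rq // andbT bnd_simp lt_lexi_square aq.
- exists (clamp 0), x; split => // q /andP[q0 qx]; apply: iN => /=.
  by rewrite itv_boundlr rq // andbT (itv_open_ends_linfty oi).
Qed.

Local Notation corner := ((clamp 0, clamp 1) : O).

Lemma first_fiberE p : (p < corner)%O -> p = lfiber (clamp 0) (val p.2).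
Proof.
case: p => a b; rewrite lt_lexi_square /= ltNge clamp0_le /=.
by move=> /andP[/eqP -> _]; rewrite /lfiber clampK.
Qed.

Lemma first_fiber_separable : `]-oo, corner[ `<=` separable_at.
Proof.
move=> p; apply: separable_at_curve (@continuous_lfiber (clamp 0)) _ _.
  exact: lray_open.
by move=> q /=; rewrite in_itv /= => /first_fiberE ->; exists (val q.2).
Qed.

(** The closure of the ray can add only the corner, which is not separable. *)
Lemma absorbing_first_fiber : absorbing separable_at `]-oo, corner[.
Proof.
apply: clopen_absorbing; first exact: lray_open.
move=> p [pc psep].
have : `]-oo, corner]%classic p.
  rewrite ((closure_id _).1 (@lray_closed _ _ corner)).
  by apply: closureS pc => q /=; rewrite !in_itv /=; exact: ltW.
rewrite /= !in_itv /= le_eqVlt => /orP[/eqP pE|//].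
by case: (@not_separable_at_top (clamp 0)); [exact: lt_clamp|rewrite -pE].
Qed.

Lemma lexi_not_transitive (G : groupType) (act : G -> O -> O) :
  transformation_group act -> ~ topological_transitive act.
Proof.
move=> actO; pose h : unit_itv R := clamp 2^-1.
have h0 : clamp 0 < h.
  by apply: lt_clamp; [exact: lexx|exact: half_gt0|exact/ltW/half_lt1].
have h1 : h < clamp 1.
  by apply: lt_clamp; [exact/ltW/half_gt0|exact: half_lt1|exact: lexx].
have i01 : clamp 0 < clamp 1 :> unit_itv R by exact: lt_clamp.
move=> /(_ _ _ (@lray_open _ _ corner) (itv_open _ _ : open (open_fiber h))).
case.
- exists (lfiber (clamp 0) 0); rewrite /= in_itv /= lt_lexi_square /=.
  by rewrite eqxx i01 orbT.
- by exists (lfiber h 2^-1); exact: open_fiber_half.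
move=> y [cgw [g _ [w hw gwE]]]; rewrite -gwE in cgw.
have gh : act g @` open_fiber h `<=` `]-oo, corner[.
  exact: (act_absorbing actO (@connected_open_fiber h) (@open_fiber_separable h)
    absorbing_first_fiber hw cgw).
have ch : continuous (act g \o lfiber h).
  move=> t; apply: continuous_comp; first exact: continuous_lfiber.
  exact: act_continuousr.
(* The ray is closed up so that the images of the two ends of the fiber stay in it. *)
have gh' : (act g \o lfiber h) @` `]0, 1[ `<=` `]-oo, corner].
  move=> _ [t t01 <-].
  have /gh : (act g @` open_fiber h) (act g (lfiber h t)).
    by exists (lfiber h t) => //; rewrite open_fiberE; exists t.
  by rewrite /= !in_itv /=; exact: ltW.
(* All points of the closed ray other than the corner are separable, and [act g] preserves
   non-separability. *)
have g_end q : ~ separable_at q -> `]-oo, corner]%classic (act g q) -> act g q = corner.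
  move=> nq; rewrite /= in_itv /= le_eqVlt => /orP[/eqP //|qc].
  exfalso; apply: nq; apply/(separable_at_actE actO g).
  by apply: first_fiber_separable; rewrite /= in_itv.
have e0 : act g (lfiber h 0) = corner.
  apply: g_end; first exact: not_separable_at_bottom.
  exact: (closed_curve_left (@ltr01 R) ch (@lray_closed _ _ _) gh').
have e1 : act g (lfiber h 1) = corner.
  apply: g_end; first exact: not_separable_at_top.
  exact: (closed_curve_right (@ltr01 R) ch (@lray_closed _ _ _) gh').
have /(can_inj (actK actO g)) [c01] : act g (lfiber h 0) = act g (lfiber h 1).
  by rewrite e0 e1.
have := @lt_clamp R 0 1 (lexx _) ltr01 (lexx _); rewrite lt_val_itv.
by rewrite /= c01 ltxx.
Qed.

End lexicographic.

Theorem theorem2p8 (R : realType) (G : groupType) :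
  (forall act : G -> alexandroff_square R -> alexandroff_square R,
     transformation_group act ->
     ~ topological_transitive act /\ ~ devaney_chaotic act) /\
  (forall act : G -> lexi_square R -> lexi_square R,
     transformation_group act ->
     ~ topological_transitive act /\ ~ devaney_chaotic act).
Proof.
split=> act actX; split=> [|[]].
- exact: alexandroff_not_transitive.
- by move=> /(alexandroff_not_transitive actX).
- exact: lexi_not_transitive.
- by move=> /(lexi_not_transitive actX).
Qed.
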